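(* Let $\mathbb{F}$ be a field of characteristic $2$ and let $0\to\mathfrak{h}\xrightarrow{i}\hat{\mathfrak{g}}\xrightarrow{\theta}\mathfrak{g}\to0$ be a central extension of restricted Lie algebras over $\mathbb{F}$. Then a pair $(\mathscr{D}_{\mathfrak{h}},\mathscr{D}_{\mathfrak{g}})\in\mathrm{Der}^2(\mathfrak{h})\times\mathrm{Der}^2(\mathfrak{g})$ is extensible if and only if its obstruction class $[(\mathrm{Ob}_{\mathrm{I}},\mathrm{Ob}_{\mathrm{II}})]\in H^2_{*2}(\mathfrak{g};\mathfrak{h})$ is trivial.
   Context: Over a field $\mathbb{F}$ of characteristic $2$: a restricted Lie algebra $(\mathfrak{g},[2])$ is a Lie algebra with a map $x\mapsto x^{[2]}$ such that $[x^{[2]},y]_{\mathfrak{g}}=[x,[x,y]_{\mathfrak{g}}]_{\mathfrak{g}}$, $(ax)^{[2]}=a^2x^{[2]}$, $(x+y)^{[2]}=x^{[2]}+y^{[2]}+[x,y]_{\mathfrak{g}}$; it is strongly abelian if the bracket and the map $[2]$ are identically zero. $\mathrm{Der}^2(\mathfrak{g})$ is the set of restricted derivations: linear derivations $\mathscr{D}$ with $\mathscr{D}(x^{[2]})=[x,\mathscr{D}(x)]_{\mathfrak{g}}$ for all $x$. A central extension of restricted Lie algebras $0\to\mathfrak{h}\xrightarrow{i}\hat{\mathfrak{g}}\xrightarrow{\theta}\mathfrak{g}\to0$ is an exact sequence of restricted Lie algebras and morphisms of restricted Lie algebras (Lie algebra morphisms commuting with the maps $[2]$), with $\mathfrak{h}$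 strongly abelian and $[\mathfrak{h},\hat{\mathfrak{g}}]_{\hat{\mathfrak{g}}}=0$; $\mathfrak{h}$ is identified with $i(\mathfrak{h})$. A pair $(\mathscr{D}_{\mathfrak{h}},\mathscr{D}_{\mathfrak{g}})\in\mathrm{Der}^2(\mathfrak{h})\times\mathrm{Der}^2(\mathfrak{g})$ is extensible if there is $\mathscr{D}_{\hat{\mathfrak{g}}}\in\mathrm{Der}^2(\hat{\mathfrak{g}})$ with $\mathscr{D}_{\hat{\mathfrak{g}}}\circ i=i\circ\mathscr{D}_{\mathfrak{h}}$ and $\theta\circ\mathscr{D}_{\hat{\mathfrak{g}}}=\mathscr{D}_{\mathfrak{g}}\circ\theta$. Obstruction class: choose a section, i.e. a linear map $s:\mathfrak{g}\to\hat{\mathfrak{g}}$ with $\theta\circ s=\mathrm{Id}$, and set $\psi(x,y)=[s(x),s(y)]_{\hat{\mathfrak{g}}}+s([x,y]_{\mathfrak{g}})$, $\varsigma(x)=s(x)^{[2]_{\hat{\mathfrak{g}}}}+s(x^{[2]_{\mathfrak{g}}})$ (with values in $\mathfrak{h}$), and $\mathrm{Ob}_{\mathrm{I}}(x,y)=\mathscr{D}_{\mathfrak{h}}(\psi(x,y))+\psi(\mathscr{D}_{\mathfrak{g}}(x),y)+\psi(x,\mathscr{D}_{\mathfrak{g}}(y))$, $\mathrm{Ob}_{\mathrm{II}}(x)=\mathscr{D}_{\mathfrak{h}}(\varsigma(x))+\psi(x,\mathscr{D}_{\mathfrak{g}}(x))$. The pair $(\mathrm{Ob}_{\mathrm{I}},\mathrm{Ob}_{\mathrm{II}})$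 is a 2-cocycle whose class in $H^2_{*2}(\mathfrak{g};\mathfrak{h})$ is independent of $s$; this class is the obstruction class of $(\mathscr{D}_{\mathfrak{h}},\mathscr{D}_{\mathfrak{g}})$. Cohomology with values in the trivial representation $(\mathfrak{h},0)$: $C^2_{*2}(\mathfrak{g};\mathfrak{h})$ is the set of pairs $(\varphi,\omega)$ with $\varphi:\wedge^2\mathfrak{g}\to\mathfrak{h}$ alternating bilinear and $\omega:\mathfrak{g}\to\mathfrak{h}$ with $\omega(ax)=a^2\omega(x)$, $\omega(x+y)=\omega(x)+\omega(y)+\varphi(x,y)$. It is a 2-cocycle (element of $Z^2_{*2}$) if $\varphi(x,[y,z]_{\mathfrak{g}})+\varphi(y,[z,x]_{\mathfrak{g}})+\varphi(z,[x,y]_{\mathfrak{g}})=0$ and $\varphi(x^{[2]_{\mathfrak{g}}},y)+\varphi([x,y]_{\mathfrak{g}},x)=0$ for all $x,y,z\in\mathfrak{g}$. Coboundaries $B^2_{*2}$: the pairs $\partial^1\gamma=(d^1\gamma,\omega_\gamma)$, $d^1\gamma(x,y)=\gamma([x,y]_{\mathfrak{g}})$, $\omega_\gamma(x)=\gamma(x^{[2]_{\mathfrak{g}}})$, for $\gamma:\mathfrak{g}\to\mathfrak{h}$ linear. $H^2_{*2}(\mathfrak{g};\mathfrak{h})=Z^2_{*2}/B^2_{*2}$. *)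

(* Defs.v *)
From HB Require Import structures.
From mathcomp Require Import all_boot all_algebra.
From mathcomp Require Import boolp classical_sets functions.

Set Implicit Arguments.
Unset Strict Implicit.
Unset Printing Implicit Defensive.

Import GRing.Theory.

Local Open Scope ring_scope.

(* [lie x y] is the bracket [x, y]; no finite-dimensionality is assumed. *)
HB.mixin Record Lmodule_isLie (F : fieldType) V of GRing.Lmodule F V := {
  lie : V -> V -> V;
  lieDl : forall x y z, lie (x + y) z = lie x z + lie y z;
  lieZl : forall (a : F) x y, lie (a *: x) y = a *: lie x y;
  lieDr : forall x y z, lie x (y + z) = lie x y + lie x z;
  lieZr : forall (a : F) x y, lie x (a *: y) = a *: lie x y;
  liexx : forall x, lie x x = 0;
  lie_jacobi : forall x y z,
    lie x (lie y z) + lie y (lie z x) + lie z (lie x y) = 0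
}.

#[short(type="lieAlgType")]
HB.structure Definition LieAlg (F : fieldType) :=
  {V of GRing.Lmodule F V & Lmodule_isLie F V}.

(* [pow2 x] is x^[2]; these are the axioms of a restricted Lie algebra in
   characteristic 2. That F has characteristic 2 is a separate hypothesis. *)
HB.mixin Record Lie_isRestricted2 (F : fieldType) V of LieAlg F V := {
  pow2 : V -> V;
  lie_pow2 : forall x y : V, lie (pow2 x) y = lie x (lie x y);
  pow2Z : forall (a : F) (x : V), pow2 (a *: x) = a ^+ 2 *: pow2 x;
  pow2D : forall x y : V, pow2 (x + y) = pow2 x + pow2 y + lie x y
}.

#[short(type="restrictedLieType")]
HB.structure Definition RestrictedLie (F : fieldType) :=
  {V of LieAlg F V & Lie_isRestricted2 F V}.

Definition strongly_abelian (F : fieldType) (g : restrictedLieType F) : Prop :=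
  (forall x y : g, lie x y = 0) /\ (forall x : g, pow2 x = 0).

Record restricted_morphism (F : fieldType) (g1 g2 : restrictedLieType F) :=
  RestrictedMorphism {
    rmor_linear :> {linear g1 -> g2};
    rmor_lie : forall x y,
      rmor_linear (lie x y) = lie (rmor_linear x) (rmor_linear y);
    rmor_pow2 : forall x, rmor_linear (pow2 x) = pow2 (rmor_linear x)
  }.

Record der2 (F : fieldType) (g : restrictedLieType F) := Der2 {
  der2_linear :> {linear g -> g};
  der2_lie : forall x y,
    der2_linear (lie x y) = lie (der2_linear x) y + lie x (der2_linear y);
  der2_pow2 : forall x, der2_linear (pow2 x) = lie x (der2_linear x)
}.

Section Cohomology.
Variables (F : fieldType) (g : restrictedLieType F) (h : lmodType F).

Definition alternating_bilinear (phi : g -> g -> h) : Prop :=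
  [/\ forall x, phi x x = 0,
      forall (a : F) x y z, phi (a *: x + y) z = a *: phi x z + phi y z
    & forall (a : F) x y z, phi x (a *: y + z) = a *: phi x y + phi x z].

Definition is_cochain2 (c : (g -> g -> h) * (g -> h)) : Prop :=
  [/\ alternating_bilinear c.1,
      forall (a : F) x, c.2 (a *: x) = a ^+ 2 *: c.2 x
    & forall x y, c.2 (x + y) = c.2 x + c.2 y + c.1 x y].

Definition is_cocycle2 (c : (g -> g -> h) * (g -> h)) : Prop :=
  [/\ is_cochain2 c,
      forall x y z,
        c.1 x (lie y z) + c.1 y (lie z x) + c.1 z (lie x y) = 0
    & forall x y, c.1 (pow2 x) y + c.1 (lie x y) x = 0].

Definition cocycle2_pred : {pred (g -> g -> h) * (g -> h)} :=
  fun c => `[< is_cocycle2 c >].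

Fact cocycle2_pred_zmod : zmod_closed cocycle2_pred.
Proof.
split=> [|c d /asboolP cP /asboolP dP]; apply/asboolP.
  split=> [|x y z|x y] /=; rewrite ?addr0 //.
  by split=> [|a x|x y] /=; rewrite ?addr0 ?scaler0 //; split=> *;
     rewrite ?addr0 ?scaler0.
case: c d cP dP => [p w] [q v] [[[p0 pl pr] wZ wD] pJ pS]
  [[[q0 ql qr] vZ vD] qJ qS].
move: p0 pl pr wZ wD pJ pS q0 ql qr vZ vD qJ qS => /=.
move=> p0 pl pr wZ wD pJ pS q0 ql qr vZ vD qJ qS.
have E x y : (p - q) x y = p x y - q x y by [].
have E2 x : (w - v) x = w x - v x by [].
split=> [|x y z|x y] /=.
- split=> [|a x|x y] /=.
  + split=> [x|a x y z|a x y z]; rewrite !E.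
    * by rewrite p0 q0 subr0.
    * by rewrite pl ql scalerBr opprD addrACA.
    * by rewrite pr qr scalerBr opprD addrACA.
  + by rewrite !E2 wZ vZ scalerBr.
  + by rewrite E !E2 wD vD !opprD !addrA [LHS](AC 6 (1*4*2*5*3*6)).
- rewrite !E -[RHS](subr0 0) -{1}(pJ x y z) -(qJ x y z) !opprD !addrA.
  by rewrite [LHS](AC 6 (1*3*5*2*4*6)).
- rewrite !E -[RHS](subr0 0) -{1}(pS x y) -(qS x y) opprD !addrA.
  by rewrite [LHS](AC 4 (1*3*2*4)).
Qed.

HB.instance Definition _ :=
  GRing.isZmodClosed.Build _ cocycle2_pred cocycle2_pred_zmod.

Record cocycle2 := Cocycle2 {
  cocycle2_val :> (g -> g -> h) * (g -> h);
  _ : cocycle2_val \in cocycle2_pred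
}.

HB.instance Definition _ := [isSub for cocycle2_val].
HB.instance Definition _ := [Choice of cocycle2 by <:].
HB.instance Definition _ := [SubChoice_isSubZmodule of cocycle2 by <:].

Lemma cocycle2P (c : cocycle2) : is_cocycle2 c.
Proof. by case: c => c /= /asboolP. Qed.

Definition mk_cocycle2 c (cP : is_cocycle2 c) : cocycle2 :=
  Cocycle2 (asboolT cP).

Fact coboundary2_subproof (gamma : {linear g -> h}) :
  is_cocycle2 (fun x y => gamma (lie x y), fun x => gamma (pow2 x)).
Proof.
have lieC (x y : g) : lie x y + lie y x = 0.
  have := liexx (x + y).
  by rewrite lieDl !lieDr !liexx add0r addr0.
split=> [|x y z|x y] /=.
- split=> [|a x|x y] /=.
  + split=> [x|a x y z|a x y z]; first by rewrite liexx linear0.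
    * by rewrite lieDl lieZl linearP.
    * by rewrite lieDr lieZr linearP.
  + by rewrite pow2Z linearZ.
  + by rewrite pow2D !linearD.
- by rewrite -!linearD /= lie_jacobi linear0.
- by rewrite -linearD /= lie_pow2 lieC linear0.
Qed.

Definition coboundary2 (gamma : {linear g -> h}) : cocycle2 :=
  mk_cocycle2 (coboundary2_subproof gamma).

Definition coboundary2_pred : {pred cocycle2} :=
  fun c => `[< exists gamma : {linear g -> h}, c = coboundary2 gamma >].

Fact coboundary2_pred_zmod : zmod_closed coboundary2_pred.
Proof.
split=> [|c d /asboolP[u ->] /asboolP[v ->]]; apply/asboolP.
  by exists \0; apply/val_inj.
by exists (u \- v); apply/val_inj.
Qed.

HB.instance Definition _ :=
  GRing.isZmodClosed.Build _ coboundary2_pred coboundary2_pred_zmod.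

(* Z^2 / B^2 with coefficients in the trivial representation h. Only the
   additive group structure of the quotient is recorded: it suffices to say
   that a class is trivial. *)
Definition H2 := {ideal_quot coboundary2_pred}.

Definition H2_class (c : cocycle2) : H2 :=
  (\pi_{ideal_quot coboundary2_pred} c)%qT.

Lemma H2_class_eq (c d : cocycle2) :
  H2_class c = H2_class d <->
  exists gamma : {linear g -> h}, c - d = coboundary2 gamma.
Proof.
split=> [/eqP|[gamma cd]]; first by rewrite -Quotient.idealrBE => /asboolP.
by apply/eqP; rewrite -Quotient.idealrBE; apply/asboolP; exists gamma.
Qed.

Lemma H2_class0 (c : cocycle2) :
  H2_class c = 0 <-> exists gamma : {linear g -> h}, c = coboundary2 gamma.
Proof.
have -> : 0 = H2_class 0 by rewrite /H2_class raddf0.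
by rewrite H2_class_eq subr0.
Qed.

End Cohomology.

Record central_extension (F : fieldType) (h ghat g : restrictedLieType F) :=
  CentralExtension {
    ext_i : restricted_morphism h ghat;
    ext_theta : restricted_morphism ghat g;
    ext_i_inj : injective ext_i;
    ext_exact : forall z, ext_theta z = 0 <-> exists a, ext_i a = z;
    ext_theta_surj : forall x, exists z, ext_theta z = x;
    ext_abelian : strongly_abelian h;
    ext_central : forall a z, lie (ext_i a) z = 0
  }.

Record ext_section (F : fieldType) (h ghat g : restrictedLieType F)
    (E : central_extension h ghat g) := ExtSection {
  section_linear :> {linear g -> ghat};
  section_thetaK : forall x, ext_theta E (section_linear x) = x
}.

Definition extensible (F : fieldType) (h ghat g : restrictedLieType F)
    (E : central_extension h ghat g) (Dh : der2 h) (Dg : der2 g) : Prop :=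
  exists Dhat : der2 ghat,
    (forall a, Dhat (ext_i E a) = ext_i E (Dh a)) /\
    (forall z, ext_theta E (Dhat z) = Dg (ext_theta E z)).

Section Obstruction.
Variables (F : fieldType) (charF : 2%N \in [pchar F]).
Variables (h ghat g : restrictedLieType F) (E : central_extension h ghat g).

(* The inverse of i on its image, with junk value 0 elsewhere; it implements
   the identification of h with i(h). *)
Definition ext_i_inv (z : ghat) : h := xget 0 [set a | ext_i E a = z]%classic.

Definition ext_psi (s : ext_section E) (x y : g) : h :=
  ext_i_inv (lie (s x) (s y) + s (lie x y)).

Definition ext_varsigma (s : ext_section E) (x : g) : h :=
  ext_i_inv (pow2 (s x) + s (pow2 x)).

Definition ObI (Dh : der2 h) (Dg : der2 g) (s : ext_section E) (x y : g) : h :=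
  Dh (ext_psi s x y) + ext_psi s (Dg x) y + ext_psi s x (Dg y).

Definition ObII (Dh : der2 h) (Dg : der2 g) (s : ext_section E) (x : g) : h :=
  Dh (ext_varsigma s x) + ext_psi s x (Dg x).

Let addvv (V : lmodType F) (v : V) : v + v = 0.
Proof. by rewrite -mulr2n -scaler_nat (pcharf0 charF) scale0r. Qed.

Let oppv (V : lmodType F) (v : V) : - v = v.
Proof. by apply/eqP; rewrite eq_sym -addr_eq0 addvv. Qed.

Lemma ext_i_invK (z : ghat) : ext_theta E z = 0 -> ext_i E (ext_i_inv z) = z.
Proof. by move=> /ext_exact; exact: xgetPex. Qed.

Lemma ext_psiE (s : ext_section E) x y :
  ext_i E (ext_psi s x y) = lie (s x) (s y) + s (lie x y).
Proof.
by apply: ext_i_invK; rewrite linearD /= rmor_lie !section_thetaK addvv.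
Qed.

Lemma ext_varsigmaE (s : ext_section E) x :
  ext_i E (ext_varsigma s x) = pow2 (s x) + s (pow2 x).
Proof.
by apply: ext_i_invK; rewrite linearD /= rmor_pow2 !section_thetaK addvv.
Qed.

Let lieC (V : lieAlgType F) (x y : V) : lie x y = lie y x.
Proof.
have := liexx (x + y); rewrite lieDl !lieDr !liexx add0r addr0.
by move/eqP; rewrite addr_eq0 oppv => /eqP.
Qed.

Let iD (a b : h) : ext_i E (a + b) = ext_i E a + ext_i E b.
Proof. exact: linearD. Qed.

Let iZ (k : F) (a : h) : ext_i E (k *: a) = k *: ext_i E a.
Proof. exact: linearZ. Qed.

Let s_lie (s : ext_section E) x y :
  s (lie x y) = lie (s x) (s y) + ext_i E (ext_psi s x y).
Proof. by rewrite ext_psiE addrA addvv add0r. Qed.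

Let s_pow2 (s : ext_section E) x :
  s (pow2 x) = pow2 (s x) + ext_i E (ext_varsigma s x).
Proof. by rewrite ext_varsigmaE addrA addvv add0r. Qed.

Let lie_ir (a : h) z : lie z (ext_i E a) = 0.
Proof. by rewrite lieC ext_central. Qed.

Lemma ext_cocycle_subproof (s : ext_section E) :
  is_cocycle2 (ext_psi s, ext_varsigma s).
Proof.
split=> [|x y z|x y] /=.
- split=> [|a x|x y] /=.
  + split=> [x|a x y z|a x y z]; apply: (@ext_i_inj _ _ _ _ E);
      rewrite ?iD ?iZ !ext_psiE.
    * by rewrite !liexx !linear0 addr0.
    * by rewrite lieDl lieZl !linearP lieDl lieZl scalerDr /= addrACA.
    * by rewrite lieDr lieZr !linearP lieDr lieZr scalerDr /= addrACA.
  + apply: (@ext_i_inj _ _ _ _ E); rewrite iZ !ext_varsigmaE.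
    by rewrite pow2Z !linearZ /= pow2Z scalerDr.
  + apply: (@ext_i_inj _ _ _ _ E); rewrite !iD !ext_varsigmaE ext_psiE.
    rewrite pow2D !linearD /= pow2D !addrA.
    by rewrite [LHS](AC 6 (1*4*2*5*3*6)).
- apply: (@ext_i_inj _ _ _ _ E); rewrite !iD linear0 !ext_psiE.
  rewrite [LHS](AC (2*2*2) ((1*3*5)*(2*4*6))) /= -!linearD /=.
  rewrite lie_jacobi linear0 addr0 !s_lie !lieDr !lie_ir !addr0.
  exact: lie_jacobi.
- apply: (@ext_i_inj _ _ _ _ E); rewrite !iD linear0 !ext_psiE.
  rewrite addrACA -linearD /= lie_pow2 (lieC (lie x y) x) addvv linear0 addr0.
  rewrite s_pow2 s_lie !lieDl !ext_central !addr0 lie_pow2.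
  by rewrite (lieC (lie (s x) (s y))) addvv.
Qed.

Lemma Ob_cocycle (Dh : der2 h) (Dg : der2 g) (s : ext_section E) :
  is_cocycle2 (ObI Dh Dg s, ObII Dh Dg s).
Proof.
rewrite /ObI /ObII.
have := ext_cocycle_subproof s.
move: (ext_psi s) (ext_varsigma s) => p w [] [] [] /= p0 pl pr wZ wD pJ pS.
have pDl x y z : p (x + y) z = p x z + p y z.
  by rewrite -[x]scale1r pl !scale1r.
have pDr x y z : p x (y + z) = p x y + p x z.
  by rewrite -[y]scale1r pr !scale1r.
have pC x y : p x y = p y x.
  have := p0 (x + y); rewrite pDl !pDr !p0 add0r addr0.
  by move/eqP; rewrite addr_eq0 oppv => /eqP.
have pr0 x : p x 0 = 0.
  by have /(congr1 (+%R^~ (p x 0))) := pDr x 0 0;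
    rewrite addr0 -addrA addvv addr0.
have pZr (k : F) x y : p x (k *: y) = k *: p x y.
  by rewrite -[k *: y]addr0 pr pr0 addr0.
have pZl (k : F) x y : p (k *: x) y = k *: p x y by rewrite pC pZr pC.
split=> [|x y z|x y] /=.
- split=> [|a x|x y] /=.
  + split=> [x|a x y z|a x y z].
    * by rewrite p0 linear0 add0r (pC x) addvv.
    * rewrite pl !linearP /= !pl !scalerDr !addrA.
      by rewrite [LHS](AC 6 (1*3*5*2*4*6)).
    * rewrite pr !linearP /= !pr !scalerDr !addrA.
      by rewrite [LHS](AC 6 (1*3*5*2*4*6)).
  + by rewrite wZ !linearZ /= pZl pZr scalerA -expr2 scalerDr.
  + rewrite wD !linearD /= !pDl !pDr (pC y (Dg x)) !addrA.
    by rewrite [LHS](AC 7 (1*4*2*7*3*6*5)) /=.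
- have J1 := pJ (Dg x) y z; have J2 := pJ x (Dg y) z; have J3 := pJ x y (Dg z).
  rewrite !der2_lie !pDr !addrA.
  rewrite [LHS](AC 12 ((1*5*9)*(2*8*11)*(3*6*12)*(4*7*10))) /=.
  by rewrite -!linearD /= pJ linear0 J1 J2 J3 !addr0.
- rewrite !der2_lie der2_pow2 pDl !addrA.
  have S1 := pS x (Dg y); have J := pJ (Dg x) x y.
  rewrite [LHS](AC 7 ((1*4)*(3*6)*(7*5*2))) /=.
  rewrite -linearD /= pS linear0 S1 !add0r -J.
  by rewrite (pC (lie x y)) (pC (lie x _)) (pC (lie _ y)) (lieC y (Dg x))
     (lieC (Dg x) x).
Qed.

Definition Ob (Dh : der2 h) (Dg : der2 g) (s : ext_section E) : cocycle2 g h :=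
  mk_cocycle2 (Ob_cocycle Dh Dg s).

Lemma H2_class_Ob (Dh : der2 h) (Dg : der2 g) (s t : ext_section E) :
  H2_class (Ob Dh Dg s) = H2_class (Ob Dh Dg t).
Proof.
pose f x : h := ext_i_inv (s x - t x).
have fE x : ext_i E (f x) = s x - t x.
  by apply: ext_i_invK; rewrite linearB /= !section_thetaK subrr.
have flin : linear f.
  move=> a x y; apply: (@ext_i_inj _ _ _ _ E).
  by rewrite iD iZ !fE !linearP /= scalerN scalerBr addrACA.
pose fl : {linear g -> h} := HB.pack f (GRing.isLinear.Build F g h _ f flin).
have sE x : s x = t x + ext_i E (f x) by rewrite fE addrC subrK.
have psiE x y : ext_psi s x y = ext_psi t x y + fl (lie x y).
  apply: (@ext_i_inj _ _ _ _ E); rewrite iD !ext_psiE !sE.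
  by rewrite lieDl !lieDr !ext_central !lie_ir !addr0 addrA.
have varsigmaE x : ext_varsigma s x = ext_varsigma t x + fl (pow2 x).
  apply: (@ext_i_inj _ _ _ _ E); rewrite iD !ext_varsigmaE !sE.
  rewrite pow2D lie_ir addr0 -rmor_pow2 (ext_abelian E).2 !linear0 addr0.
  by rewrite addrA.
have DhD a b : Dh (a + b) = Dh a + Dh b by exact: linearD.
have flD a b : fl (a + b) = fl a + fl b by exact: linearD.
have ObIIE x : ObII Dh Dg s x - ObII Dh Dg t x =
    Dh (fl (pow2 x)) + fl (Dg (pow2 x)).
  rewrite /ObII psiE varsigmaE der2_pow2 DhD.
  by rewrite (addrACA (Dh _)) addrC addrK.
have ObIE x y : ObI Dh Dg s x y - ObI Dh Dg t x y =
    Dh (fl (lie x y)) + fl (Dg (lie x y)).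
  rewrite /ObI !psiE der2_lie DhD flD.
  by rewrite (addrACA (Dh _)) (addrACA (_ + ext_psi t _ _)) [LHS]addrAC
    subrr add0r addrA.
apply/H2_class_eq; exists ((Dh \o fl) \+ (fl \o Dg)).
apply/val_inj; congr pair; last exact/funext/ObIIE.
by apply/funext => x; apply/funext/ObIE.
Qed.

Lemma ext_section_exists : exists s : ext_section E, True.
Proof.
pose P (A : set (g * ghat)) :=
  [/\ forall (k : F) p q, A p -> A q -> A (k *: p + q),
      forall p, A p -> ext_theta E p.2 = p.1
    & forall z, A (0, z) -> z = 0].
have [] := @Zorn_bigcup _ P.
  move=> C CP totC; split=> [k p q [X CX Xp] [Y CY Yq]|p [X CX Xp]|z [X CX Xz]].
  - have [XY|YX] := totC _ _ CX CY.
      by exists Y => //; have [+ _ _] := CP _ CY; apply => //; apply: XY.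
    by exists X => //; have [+ _ _] := CP _ CX; apply => //; apply: YX.
  - by have [_ + _] := CP _ CX; apply.
  - by have [_ _] := CP _ CX; apply.
move=> A [[Alin Ath A0] maxA].
have AZ k p : A p -> A (k *: p).
  move=> Ap; have := Alin (k - 1) p p Ap Ap.
  by rewrite -{2}[p]scale1r -scalerDl subrK.
have A00 : A 0.
  apply: contrapT => nA0; have nA p : ~ A p.
    by move=> /(AZ 0); rewrite scale0r.
  apply: (maxA [set 0]%classic).
    split=> [p /nA //|sub].
    exact: (nA0 (sub 0 erefl)).
  by split=> [k p q -> ->|p ->|z []] //=; rewrite ?scaler0 ?addr0 ?linear0.
have Atot x : exists z, A (x, z).
  apply: contrapT => nAx; have [w wE] := ext_theta_surj E x.
  apply: (maxA [set p | exists a q, A q /\ p = a *: (x, w) + q]%classic).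
    split=> [p Ap|sub]; first by exists 0, p; rewrite scale0r add0r.
    apply: nAx; exists w; apply: sub.
    by exists 1, 0; rewrite scale1r addr0.
  split=> [k p q [a [p' [Ap ->]]] [b [q' [Aq ->]]]|p [a [q [Aq ->]]]|z].
  - exists (k * a + b), (k *: p' + q'); split; first exact: Alin.
    by rewrite scalerDr scalerA addrACA -scalerDl.
  - by rewrite /= linearP /= wE Ath.
  - move=> [a [[q1 q2] [Aq [q1E ->]]]].
    have [a0|a0] := eqVneq a 0.
      by move: q1E Aq; rewrite a0 !scale0r !add0r => <- /A0.
    case: nAx; exists (- a^-1 *: q2).
    suff -> : (x, - a^-1 *: q2) = - a^-1 *: (q1, q2) by exact: AZ.
    congr pair; move/esym/eqP: q1E; rewrite addrC addr_eq0 => /eqP ->.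
    by rewrite scalerN scaleNr opprK scalerA mulVf // scale1r.
have Auniq x z z' : A (x, z) -> A (x, z') -> z = z'.
  move=> Az Az'; apply/esym/eqP; rewrite -subr_eq0; apply/eqP/A0.
  have := Alin (-1) _ _ Az Az'.
  by congr A; congr pair; rewrite /= scaleN1r addrC // subrr.
pose f x : ghat := xget 0 [set z | A (x, z)]%classic.
have fP x : A (x, f x) by exact: xgetPex (Atot x).
have flin : linear f.
  by move=> k x y; apply: (Auniq (k *: x + y)) => //; exact: Alin (fP x) (fP y).
pose fl : {linear g -> ghat} :=
  HB.pack f (GRing.isLinear.Build F g ghat _ f flin).
have flK x : ext_theta E (fl x) = x by exact: Ath (fP x).
by exists (ExtSection flK).
Qed.

(* The section is picked by choice; [obstruction_classE] shows that any other
   one gives the same class. *)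
Definition obstruction_class (Dh : der2 h) (Dg : der2 g) : H2 g h :=
  H2_class (Ob Dh Dg (projT1 (cid ext_section_exists))).

Lemma obstruction_classE (Dh : der2 h) (Dg : der2 g) (s : ext_section E) :
  obstruction_class Dh Dg = H2_class (Ob Dh Dg s).
Proof. exact: H2_class_Ob. Qed.

End Obstruction.

(* Main.v *)
Require Import Defs.
From HB Require Import structures.
From mathcomp Require Import all_boot all_algebra.
From mathcomp Require Import boolp classical_sets functions.

(** Fix a linear section [s] of [theta]. Since [h] is central and strongly
abelian, brackets and squares in [ghat] depend only on the images under
[theta]: [lie z w = lie (s x) (s y)] and [pow2 z = pow2 (s x)] for
[x = theta z] and [y = theta w] ([lie_section], [pow2_section]). A linear map
[Dhat] on [ghat] compatible with [Dh] and [Dg] amounts to a linear map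
[gamma : g -> h], through [Dhat (s x) = s (Dg x) + i (gamma x)]. Expanding the
two conditions for [Dhat] to be a restricted derivation turns them into
[ObI x y = gamma (lie x y)] and [ObII x = gamma (pow2 x)], that is, into the
statement that the coboundary of [gamma] is the obstruction cocycle of [s],
whose class does not depend on [s].

The lemma [extensible_coboundary_primitive] reads [gamma] off an extension
[Dhat]; conversely, [coboundary_primitive_extensible] puts
[Dhat z = s (Dg (theta z)) + i (gamma (theta z)) + i (Dh (a z))], where [a z]
is the [h]-component of [z], given by [i (a z) = z - s (theta z)]. *)

Set Implicit Arguments.
Unset Strict Implicit.
Unset Printing Implicit Defensive.

Import GRing.Theory.

Local Open Scope ring_scope.

Lemma pchar2_addvv (F : fieldType) (V : lmodType F) :
  2%N \in [pchar F] -> forall v : V, v + v = 0.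
Proof.
by move=> charF v; rewrite -mulr2n -scaler_nat (pcharf0 charF) scale0r.
Qed.

Lemma pchar2_addvK (F : fieldType) (V : lmodType F) :
  2%N \in [pchar F] -> forall u v : V, u + v + v = u.
Proof. by move=> charF u v; rewrite -addrA pchar2_addvv // addr0. Qed.

Lemma pchar2_oppv (F : fieldType) (V : lmodType F) :
  2%N \in [pchar F] -> forall v : V, - v = v.
Proof.
by move=> charF v; apply/eqP; rewrite eq_sym -addr_eq0 pchar2_addvv.
Qed.

Section CentralExtension.
Variables (F : fieldType) (charF : 2%N \in [pchar F]).
Variables (h ghat g : restrictedLieType F) (E : central_extension h ghat g).

Let addvv (V : lmodType F) := @pchar2_addvv F V charF.
Let addvK (V : lmodType F) := @pchar2_addvK F V charF.
Let oppv (V : lmodType F) := @pchar2_oppv F V charF.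

Lemma ext_lie_ir (a : h) (z : ghat) : lie z (ext_i E a) = 0.
Proof.
have := liexx (z + ext_i E a).
by rewrite lieDl !lieDr !liexx ext_central !addr0 add0r.
Qed.

Lemma ext_theta_i (a : h) : ext_theta E (ext_i E a) = 0.
Proof. by apply/ext_exact; exists a. Qed.

(** A linear map killed by [theta] factors linearly through [i]. *)
Lemma linear_factor_ext_i (V : lmodType F) (f : {linear V -> ghat}) :
  (forall v, ext_theta E (f v) = 0) ->
  exists u : {linear V -> h}, forall v, ext_i E (u v) = f v.
Proof.
move=> fK; pose u v := ext_i_inv E (f v).
have uE v : ext_i E (u v) = f v by exact: ext_i_invK.
have ulin : linear u.
  move=> k x y; apply: (@ext_i_inj _ _ _ _ E).
  by rewrite linearP /= !uE linearP.
pose ul : {linear V -> h} := HB.pack u (GRing.isLinear.Build F V h _ u ulin).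
by exists ul.
Qed.

Section FixedSection.
Variable s : ext_section E.

(** The component in [h] of an element of [ghat] relative to [s]. *)
Lemma ext_component_exists :
  exists a : {linear ghat -> h},
    forall z, ext_i E (a z) = z - s (ext_theta E z).
Proof.
have [|a aE] := @linear_factor_ext_i ghat
  ((idfun : {linear ghat -> ghat}) \- (s \o ext_theta E)).
  by move=> z /=; rewrite linearB /= section_thetaK subrr.
by exists a.
Qed.

Lemma ext_decomposition z :
  exists a, z = s (ext_theta E z) + ext_i E a.
Proof.
have [a aE] := ext_component_exists.
by exists (a z); rewrite aE addrC subrK.
Qed.

Lemma lie_section z w :
  lie z w = lie (s (ext_theta E z)) (s (ext_theta E w)).
Proof.
have [a {1}->] := ext_decomposition z; have [b {1}->] := ext_decomposition w.
by rewrite lieDl ext_central addr0 lieDr ext_lie_ir addr0.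
Qed.

Lemma pow2_section z : pow2 z = pow2 (s (ext_theta E z)).
Proof.
have [a {1}->] := ext_decomposition z.
by rewrite pow2D ext_lie_ir -rmor_pow2 (ext_abelian E).2 linear0 !addr0.
Qed.

Variables (Dh : der2 h) (Dg : der2 g).

Lemma ext_i_ObI x y :
  ext_i E (ObI Dh Dg s x y) =
  ext_i E (Dh (ext_psi s x y)) +
    (lie (s (Dg x)) (s y) + lie (s x) (s (Dg y))) + s (Dg (lie x y)).
Proof.
rewrite /ObI der2_lie !linearD /= !ext_psiE // -!addrA; congr (_ + _).
by rewrite [LHS]addrA [RHS]addrA addrACA !addrA.
Qed.

Lemma ext_i_ObII x :
  ext_i E (ObII Dh Dg s x) =
  ext_i E (Dh (ext_varsigma s x)) + lie (s x) (s (Dg x)) + s (Dg (pow2 x)).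
Proof. by rewrite /ObII der2_pow2 linearD /= ext_psiE // addrA. Qed.

(** [gamma] is a primitive of the obstruction cocycle computed with [s]. *)
Definition coboundary_primitive (gamma : g -> h) : Prop :=
  (forall x y, ObI Dh Dg s x y = gamma (lie x y)) /\
  (forall x, ObII Dh Dg s x = gamma (pow2 x)).

Lemma obstruction_class_eq0 :
  obstruction_class charF E Dh Dg = 0 <->
  exists gamma : {linear g -> h}, coboundary_primitive gamma.
Proof.
rewrite (obstruction_classE charF Dh Dg s) H2_class0.
split=> [[gamma /(congr1 val) /= [e1 e2]]|[gamma [e1 e2]]]; exists gamma.
  split=> [x y|x]; first by rewrite e1.
  by rewrite e2.
apply/val_inj; congr pair; last exact/funext/e2.
by apply/funext => x; apply/funext/e1.
Qed.

Lemma extensible_coboundary_primitive :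
  extensible E Dh Dg ->
  exists gamma : {linear g -> h}, coboundary_primitive gamma.
Proof.
move=> [Dhat [Di Dth]].
have [|gamma gammaE] := @linear_factor_ext_i g ((Dhat \o s) \+ (s \o Dg)).
  by move=> x /=; rewrite linearD /= Dth !section_thetaK addvv.
exists gamma; rewrite /= in gammaE.
(* [Dhat (s x)] and [s (Dg x)] have the same image in [g], so they are
   interchangeable inside a bracket. *)
split=> [x y|x]; apply: (@ext_i_inj _ _ _ _ E).
- rewrite ext_i_ObI gammaE -Di ext_psiE // linearD /= der2_lie.
  rewrite (lie_section (Dhat (s x))) (lie_section (s x) (Dhat _)).
  rewrite !Dth !section_thetaK.
  by set C := lie _ _ + lie _ _; rewrite (addrC C) addvK.
- rewrite ext_i_ObII gammaE -Di ext_varsigmaE // linearD /= der2_pow2.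
  rewrite (lie_section (s x) (Dhat _)).
  by rewrite !Dth !section_thetaK (addrC (lie _ _)) addvK.
Qed.

Lemma coboundary_primitive_extensible (gamma : {linear g -> h}) :
  coboundary_primitive gamma -> extensible E Dh Dg.
Proof.
move=> [gammaI gammaII]; have [a aE] := ext_component_exists.
have a_i b : a (ext_i E b) = b.
  apply: (@ext_i_inj _ _ _ _ E).
  by rewrite aE ext_theta_i linear0 subr0.
have a_lie z w : a (lie z w) = ext_psi s (ext_theta E z) (ext_theta E w).
  apply: (@ext_i_inj _ _ _ _ E).
  by rewrite aE ext_psiE // rmor_lie -lie_section oppv.
have a_pow2 z : a (pow2 z) = ext_varsigma s (ext_theta E z).
  apply: (@ext_i_inj _ _ _ _ E).
  by rewrite aE ext_varsigmaE // rmor_pow2 -pow2_section oppv.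
pose D : {linear ghat -> ghat} :=
  ((s \o (Dg \o ext_theta E)) \+ (ext_i E \o (gamma \o ext_theta E)))
    \+ (ext_i E \o (Dh \o a)).
have DE z : D z = s (Dg (ext_theta E z)) + ext_i E (gamma (ext_theta E z))
    + ext_i E (Dh (a z)) by [].
have Dth z : ext_theta E (D z) = Dg (ext_theta E z).
  by rewrite DE !linearD /= !ext_theta_i !addr0 section_thetaK.
have Dlie z w : D (lie z w) = lie (D z) w + lie z (D w).
  rewrite DE a_lie rmor_lie -gammaI ext_i_ObI.
  rewrite (lie_section (D z)) (lie_section z) !Dth.
  set A := s _; set B := ext_i E _; set C := lie _ _ + lie _ _.
  by rewrite (addrC A) addvK addrC addrA addvv add0r.
have Dpow2 z : D (pow2 z) = lie z (D z).
  rewrite DE a_pow2 rmor_pow2 -gammaII ext_i_ObII (lie_section z) Dth.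
  set A := s (Dg _); set B := ext_i E _; set C := lie _ _.
  by rewrite (addrC A) addvK addrC addrA addvv add0r.
exists (Der2 Dlie Dpow2); split=> [b|z]; last exact: Dth.
by rewrite -[LHS]/(D (ext_i E b)) DE a_i ext_theta_i !linear0 !add0r.
Qed.

End FixedSection.
End CentralExtension.

Theorem theorem6p4 (F : fieldType) (charF : 2%N \in [pchar F])
    (h ghat g : restrictedLieType F) (E : central_extension h ghat g)
    (Dh : der2 h) (Dg : der2 g) :
  extensible E Dh Dg <-> obstruction_class charF E Dh Dg = 0.
Proof.
have [s _] := ext_section_exists E.
rewrite (obstruction_class_eq0 charF s).
split; first exact: extensible_coboundary_primitive.
by case=> gamma; exact: coboundary_primitive_extensible.
Qed.
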